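(* Let $(\mathcal P_i,\le_i)$, $i=1,\dots,n$, be finite posets, and for each $i$ let $\mu_i,\nu_i$ be signed measures on $\mathcal P_i$ with $\mu_i\preceq_{HS}\nu_i$ on $\mathcal P_i$. Fix weights $\alpha_1,\dots,\alpha_n\ge0$ and define measures on the disjoint union $\mathcal P:=\bigsqcup_{i=1}^n\mathcal P_i$ by $$\mu:=\sum_{i=1}^n\alpha_i\mu_i,\qquad \nu:=\sum_{i=1}^n\alpha_i\nu_i,$$ where each $\mu_i,\nu_i$ is extended by zero outside $\mathcal P_i$. Then $\mu\preceq_{HS}\nu$.
   Context: For a finite poset $(\mathcal P,\le)$ and $x,z\in\mathcal P$, the hockey-stick function is $\Phi_x^{\mathcal P}(z):=\sum_{y\in\mathcal P}\mathbb 1_{\{x\le y\le z\}}$. For a signed measure $\rho$ on $\mathcal P$ and $f:\mathcal P\to\mathbb R$, $\langle\rho,f\rangle:=\int_{\mathcal P}f(x)\,\rho(dx)$. For signed measures $\mu,\nu$ on $\mathcal P$, $\mu\preceq_{HS}\nu$ means that $\langle\nu-\mu,\Phi_x^{\mathcal P}\rangle\ge0$ for every $x\in\mathcal P$. The disjoint union poset $\bigsqcup_i\mathcal P_i$ has the order: $x\le y$ if and only if $x,y$ lie in the same component $\mathcal P_i$ and $x\le_i y$; elements of different components are incomparable. *)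

(* Defs.v *)
From HB Require Import structures.
From mathcomp Require Import all_boot all_order all_algebra.
From mathcomp Require Import reals.

Set Implicit Arguments.
Unset Strict Implicit.
Unset Printing Implicit Defensive.

Import Order.TTheory GRing.Theory Num.Theory.
Local Open Scope ring_scope.

(* On a finite set, with every subset measurable, a disjoint sequence of sets  *)
(* has only finitely many nonempty terms, so countable additivity amounts to   *)
(* additivity on disjoint pairs (which also forces the empty set to have mass  *)
(* 0).  The charges of MathComp-Analysis are not used because its measurable   *)
(* types are pointed, which would exclude the empty poset.                     *)
(* Values are in R^o so that these functions form a left R-module.             *)
Section SignedMeasure.
Variables (R : realType) (T : finType).

Definition set_additive : {pred {ffun {set T} -> R^o}} :=
  [pred m : {ffun {set T} -> R^o} | [forall A : {set T}, forall B : {set T},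
     [disjoint A & B] ==> (m (A :|: B) == m A + m B)]].

Lemma set_additiveP (m : {ffun {set T} -> R^o}) :
  reflect (forall A B : {set T}, [disjoint A & B] -> m (A :|: B) = m A + m B)
          (m \in set_additive).
Proof.
apply: (iffP forallP) => [h A B dAB|h A].
  by have /forallP/(_ B)/implyP/(_ dAB)/eqP := h A.
by apply/forallP => B; apply/implyP => dAB; apply/eqP/h.
Qed.

Fact set_additive_submod_closed : submod_closed set_additive.
Proof.
split=> [|a u v /set_additiveP hu /set_additiveP hv].
  by apply/set_additiveP => A B _; rewrite !ffunE addr0.
apply/set_additiveP => A B dAB.
by rewrite !ffunE /= hu // hv // scalerDr addrACA.
Qed.

HB.instance Definition _ :=
  GRing.isSubmodClosed.Build R {ffun {set T} -> R^o} set_additive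
    set_additive_submod_closed.

Record smeasure := SMeasure {
  smeasure_val :> {ffun {set T} -> R^o};
  smeasure_valP : smeasure_val \in set_additive }.

HB.instance Definition _ := [isSub for smeasure_val].
HB.instance Definition _ := [Choice of smeasure by <:].
HB.instance Definition _ := [SubChoice_isSubLmodule of smeasure by <:].

Lemma smeasureU (m : smeasure) (A B : {set T}) :
  [disjoint A & B] -> m (A :|: B) = m A + m B.
Proof. by move: A B; apply/set_additiveP/smeasure_valP. Qed.

Lemma smeasure0 (m : smeasure) : m set0 = 0.
Proof.
have := smeasureU m (A := set0) (B := set0).
rewrite disjoints_subset sub0set setU0 => /(_ isT) /eqP.
by rewrite -subr_eq subrr eq_sym => /eqP.
Qed.

(* The integral of f against m: f takes finitely many values c, so this is the *)
(* integral of a simple function, the sum of c m(f = c).                       *)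
Definition pairing (m : smeasure) (f : T -> R) : R :=
  \sum_(c <- undup (codom f)) c * m [set x | f x == c].

Lemma smeasure_sum1 (m : smeasure) (A : {set T}) :
  m A = \sum_(x in A) (m [set x] : R).
Proof.
have [n] := ubnP #|A|; elim: n A => // n IHn A.
have [->|[a aA]] := set_0Vmem A; first by rewrite big_set0 smeasure0.
rewrite (cardsD1 a) aA ltnS => leAn; rewrite (big_setD1 a) //= -IHn //.
by rewrite -smeasureU ?setD1K // disjoints1 setD11.
Qed.

Lemma pairing_sum1 (m : smeasure) (f : T -> R) :
  pairing m f = \sum_(x : T) f x * m [set x].
Proof.
transitivity (\sum_(c <- undup (codom f)) \sum_(x | f x == c) f x * m [set x]).
  apply: eq_bigr => c _; rewrite smeasure_sum1 mulr_sumr.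
  rewrite big_mkcond [RHS]big_mkcond /=; apply: eq_bigr => x _.
  by rewrite inE; case: eqP => // ->.
under eq_bigr do rewrite big_mkcond /=.
rewrite exchange_big /=; apply: eq_bigr => x _.
rewrite (bigD1_seq (f x)) ?undup_uniq ?mem_undup ?codom_f //= eqxx.
by rewrite big1 ?addr0 // => c /negPf cfx; rewrite eq_sym cfx.
Qed.

End SignedMeasure.

Definition hockey_stick (R : realType) d (P : finPOrderType d) (x z : P) : R :=
  \sum_(y : P) ((x <= y <= z)%O)%:R.

Definition HSle (R : realType) d (P : finPOrderType d) (mu nu : smeasure R P) :=
  forall x : P, 0 <= pairing (nu - mu) (hockey_stick R x).

Fact dunion_display : Order.disp_t. Proof. exact: Order.Disp tt tt. Qed.

Section DisjointUnion.
Variables (I : finType) (d : I -> Order.disp_t).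
Variable P : forall i, finPOrderType (d i).

(* An alias, as {i : I & P i} itself gets a lexicographic order when I is      *)
(* ordered.                                                                    *)
Definition dunion : Type := {i : I & P i}.
HB.instance Definition _ := Finite.on dunion.

Definition dunion_le : rel dunion :=
  fun x y => (tag x == tag y) && (tagged x <= tagged_as x y)%O.

Fact dunion_le_refl : reflexive dunion_le.
Proof. by move=> [i x]; rewrite /dunion_le /= eqxx tagged_asE lexx. Qed.

Fact dunion_le_anti : antisymmetric dunion_le.
Proof.
move=> [i x] [j y]; rewrite /dunion_le /= => /andP[/andP[/eqP ij]].
by case: j / ij y => y; rewrite eqxx !tagged_asE /= => xy yx; congr existT;
  apply/le_anti/andP.
Qed.

Fact dunion_le_trans : transitive dunion_le.
Proof.
move=> [j y] [i x] [k z]; rewrite /dunion_le /= => /andP[/eqP ij].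
case: j / ij y => y + /andP[/eqP ik]; case: k / ik z => z.
by rewrite eqxx !tagged_asE /=; exact: le_trans.
Qed.

HB.instance Definition _ := Order.Le_isPOrder.Build dunion_display dunion
  dunion_le_refl dunion_le_anti dunion_le_trans.

Definition din (i : I) (x : P i) : dunion := Tagged (fun i => P i) x.

Section Extension.
Variables (R : realType) (i : I) (m : smeasure R (P i)).

Fact extend0_subproof :
  [ffun A : {set dunion} => m (@din i @^-1: A)] \in @set_additive R dunion.
Proof.
apply/set_additiveP => A B dAB; rewrite !ffunE preimsetU smeasureU //.
by rewrite -setI_eq0 -preimsetI (disjoint_setI0 dAB) preimset0.
Qed.

(* [@din i @^-1: A] is the intersection of A with the component P i. *)
Definition extend0 : smeasure R dunion := SMeasure extend0_subproof.

End Extension.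

End DisjointUnion.

(* Main.v *)
Require Import Defs.
From HB Require Import structures.
From mathcomp Require Import all_boot all_order all_algebra.
From mathcomp Require Import reals.

Set Implicit Arguments.
Unset Strict Implicit.
Unset Printing Implicit Defensive.

Import Order.TTheory GRing.Theory Num.Theory.
Local Open Scope ring_scope.

(* Pairing with a function on the disjoint union restricts, for a measure      *)
(* carried by one component, to pairing on that component.  The hockey-stick   *)
(* function based at a point of the j-th component vanishes off that component *)
(* and restricts on it to a hockey-stick function there, so pairing it with    *)
(* nu - mu gives alpha_j times a quantity assumed to be nonnegative.           *)

(** The order never links two components, so each test function sees a single summand of the
    mixture: [pairing_lincomb] and [pairing_extend0] split the pairing over components,
    [hockey_stick_din_neq] kills all terms but one, and [hockey_stick_din] identifies that one. *)

Section PairingLinear.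
Variables (R : realType) (T : finType).
Implicit Types (m : smeasure R T) (f : T -> R).

(** The measure comes last, and values lie in [R^o], so that the generic theory of linear maps
    applies. *)
Definition pairingr f m : R^o := pairing m f.

Fact pairingr_is_linear f : linear (pairingr f).
Proof.
move=> a m1 m2; rewrite /pairingr !pairing_sum1 scaler_sumr -big_split /=.
by apply: eq_bigr => x _; rewrite !ffunE mulrDr [f x * _]mulrCA.
Qed.

HB.instance Definition _ f :=
  GRing.isLinear.Build R (smeasure R T) R^o _ (pairingr f)
    (pairingr_is_linear f).

Lemma pairingB m1 m2 f : pairing (m1 - m2) f = pairing m1 f - pairing m2 f.
Proof. exact: (raddfB (pairingr f)). Qed.

Lemma pairing_lincomb (I : finType) (a : I -> R) (m : I -> smeasure R T) f :
  pairing (\sum_i a i *: m i) f = \sum_i a i * pairing (m i) f.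
Proof.
rewrite -[LHS]/(pairingr f _) linear_sum.
by apply: eq_bigr => i _; rewrite linearZ.
Qed.

Lemma eq_pairing m f g : f =1 g -> pairing m f = pairing m g.
Proof. by move=> fg; rewrite !pairing_sum1; under eq_bigr do rewrite fg. Qed.

Lemma pairing0r m : pairing m (fun=> 0) = 0.
Proof. by rewrite pairing_sum1 big1 // => x _; rewrite mul0r. Qed.

End PairingLinear.

Section DisjointUnionTheory.
Variables (R : realType) (I : finType) (d : I -> Order.disp_t).
Variable P : forall i, finPOrderType (d i).

Lemma big_dunion (F : dunion P -> R) :
  \sum_y F y = \sum_i \sum_(x : P i) F (din x).
Proof.
rewrite (sig_big_dep _ (fun i : I => xpredT) (fun i (x : P i) => F (din x))) /=.
by apply: eq_bigr => -[].
Qed.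

Lemma din_inj i : injective (@din I d P i).
Proof. by move=> x y /eqP; rewrite /din eq_Tagged => /eqP. Qed.

Lemma le_din i (x y : P i) : (din x <= din y :> dunion P)%O = (x <= y)%O.
Proof.
by rewrite [LHS]/(dunion_le _ _) /dunion_le eqxx /= tagged_asE.
Qed.

Lemma le_din_neq i j (x : P i) (y : P j) :
  i != j -> (din x <= din y :> dunion P)%O = false.
Proof. by move=> /negPf ij; rewrite [LHS]/(dunion_le _ _) /dunion_le /= ij. Qed.

(** Compare point masses: the preimage of a singleton under [din] is a singleton if the point lies
    in component [i], and empty otherwise. *)
Lemma pairing_extend0 i (m : smeasure R (P i)) (f : dunion P -> R) :
  pairing (extend0 m) f = pairing m (fun x => f (din x)).
Proof.
rewrite !pairing_sum1 big_dunion (bigD1 i) //= [X in _ + X]big1 ?addr0.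
  apply: eq_bigr => x _; rewrite ffunE; congr (_ * m _).
  by apply/setP => y; rewrite !inE (inj_eq (@din_inj i)).
move=> k ki; apply: big1 => x _; rewrite ffunE.
suff -> : @din I d P i @^-1: [set din x] = set0 by rewrite smeasure0 mulr0.
apply/setP => y; rewrite !inE; apply/eqP => /(congr1 tag) /= ik.
by rewrite ik eqxx in ki.
Qed.

(** An interval with endpoints in one component stays inside it. *)
Lemma hockey_stick_din i (x z : P i) :
  hockey_stick R (din x : dunion P) (din z) = hockey_stick R x z.
Proof.
rewrite /hockey_stick big_dunion (bigD1 i) //= [X in _ + X]big1 ?addr0.
  by under eq_bigr do rewrite !le_din.
by move=> k ki; apply: big1 => y _; rewrite le_din_neq // eq_sym.
Qed.

Lemma hockey_stick_din_neq i j (x : P j) (z : P i) :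
  j != i -> hockey_stick R (din x : dunion P) (din z) = 0.
Proof.
(* A point [y] in between would, by transitivity, make elements of different components
   comparable. *)
move=> ji; apply: big1 => y _; case: andP => // -[xy /(le_trans xy)].
by rewrite le_din_neq.
Qed.

End DisjointUnionTheory.

Theorem proposition5p3 (R : realType) (n : nat)
    (d : 'I_n -> Order.disp_t) (P : forall i : 'I_n, finPOrderType (d i))
    (mu nu : forall i : 'I_n, smeasure R (P i)) (alpha : 'I_n -> R)
    (munu : forall i : 'I_n, HSle (mu i) (nu i))
    (alpha_ge0 : forall i : 'I_n, 0 <= alpha i) :
  HSle (\sum_(i < n) alpha i *: extend0 (mu i) : smeasure R (dunion P))
       (\sum_(i < n) alpha i *: extend0 (nu i) : smeasure R (dunion P)).
Proof.
move=> [j x]; rewrite -/(din x).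
(* Stated for an arbitrary family [m], to serve both [mu] and [nu]. *)
have pairing_comb (m : forall i, smeasure R (P i)) :
    pairing (\sum_i alpha i *: extend0 (m i)) (hockey_stick R (din x)) =
    alpha j * pairing (m j) (hockey_stick R x).
  rewrite pairing_lincomb (bigD1 j) //= pairing_extend0.
  rewrite (eq_pairing _ (hockey_stick_din R x)) big1 ?addr0 // => i ij.
  rewrite pairing_extend0 (@eq_pairing _ _ _ _ (fun=> 0)) ?pairing0r ?mulr0 //.
  by move=> z; rewrite hockey_stick_din_neq // eq_sym.
rewrite pairingB !pairing_comb -mulrBr -pairingB.
by rewrite mulr_ge0 //; exact: munu.
Qed.
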